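(* Let $k\geq 1$ and $n\geq 2$ be integers. Then $\operatorname{depth}(S/I(P_n^k))=\left\lceil\frac{n}{2k+1}\right\rceil$.
   Context: $K$ is a field and $S=K[x_1,\dots,x_n]$ is the polynomial ring. $P_n^k$ denotes the $k$-th power of the path on the vertex set $\{1,\dots,n\}$: for $1\le i<j\le n$, $\{i,j\}$ is an edge if and only if $j-i\le k$. Its edge ideal is the squarefree monomial ideal $I(P_n^k)=(x_ix_j : 1\le i<j\le n,\ j-i\le k)\subset S$. Depth is taken with respect to the graded maximal ideal $(x_1,\dots,x_n)$. *)

(* Defs.v *)
From HB Require Import structures.
From mathcomp Require Import all_boot all_order all_algebra.
From mathcomp Require Import mpoly.

Set Implicit Arguments.
Unset Strict Implicit.
Unset Printing Implicit Defensive.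

Import GRing.Theory.
Local Open Scope ring_scope.

Section Depth.

Variable R : comNzRingType.
Implicit Types (G I m : R -> Prop) (f g p : R) (fs : seq R).

Definition ideal_gen G p : Prop :=
  exists s : seq (R * R),
    (forall cg, cg \in s -> G cg.2) /\ p = \sum_(cg <- s) cg.1 * cg.2.

(* I + (fs) *)
Definition ideal_adjoin I fs : R -> Prop :=
  ideal_gen (fun p => I p \/ p \in fs).

(* When I is an ideal: f is a nonzerodivisor on R / I, the vanishing of a class
   in R / I being membership of a representative in I.  The zero module is not
   excluded here but in regular_seq. *)
Definition regular_mod I f : Prop := forall g, I (f * g) -> I g.

(* fs is an (R / I)-regular sequence: each fs`_i is a nonzerodivisor on
   (R / I) / (fs_0, ..., fs_(i-1)) (R / I) = R / (I + (fs_0, ..., fs_(i-1))),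
   and R / (I + (fs)) is not zero. *)
Definition regular_seq I fs : Prop :=
  (forall i, (i < size fs)%N -> regular_mod (ideal_adjoin I (take i fs)) fs`_i)
  /\ ~ ideal_adjoin I fs 1.

Definition regular_seq_in m I fs : Prop :=
  (forall f, f \in fs -> m f) /\ regular_seq I fs.

(* The supremum of the lengths of the (R / I)-regular sequences in m is d;
   a finite supremum of natural numbers is attained. *)
Definition quotient_depth_eq m I (d : nat) : Prop :=
  (exists fs, regular_seq_in m I fs /\ size fs = d)
  /\ (forall fs, regular_seq_in m I fs -> (size fs <= d)%N).

End Depth.

Definition graded_maxideal (K : fieldType) (n : nat) : {mpoly K[n]} -> Prop :=
  ideal_gen (fun p => exists i : 'I_n, p = 'X_i).

Definition edge_ideal (K : fieldType) (n : nat) (e : rel 'I_n) :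
    {mpoly K[n]} -> Prop :=
  ideal_gen (fun p => exists i j : 'I_n, e i j /\ p = 'X_i * 'X_j).

(* The vertices 1, ..., n are numbered 0, ..., n-1. *)
Definition path_power (n k : nat) : rel 'I_n :=
  fun i j => (((i < j) && (j - i <= k)) || ((j < i) && (i - j <= k)))%N.

(* Main.v *)
Require Import Defs.
From HB Require Import structures.
From mathcomp Require Import all_boot all_order all_algebra.
From mathcomp Require Import mpoly ring zify.

Set Implicit Arguments.
Unset Strict Implicit.
Unset Printing Implicit Defensive.

(* Let N[v] be the closed neighbourhood of v, and let I be the edge ideal of a
   graph G.

   Lower bound. If the sets N[c_0], ..., N[c_(d-1)] are pairwise disjoint, the
   sums of variables over them form a regular sequence on S/I. A sequence that
   is regular on S/(J : x) and on S/(J + x) is regular on S/J; for J generated by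
   the edges and a set of deleted vertices, J : x_v deletes the neighbours of v
   and J + x_v deletes v. Branching until no edge is left gives polynomial rings
   modulo variables, where the forms are nonzero with disjoint supports.

   Upper bound. If A is an independent dominating set with d elements, the
   monomial u = x_A is killed in S/I by P = (x_v : v not in A). More than d
   elements f_i of the maximal ideal have algebraically dependent powers modulo
   P; cancelling along the least monomial of such a relation, if the f_i are a
   regular sequence, puts u in I + (f_i^t) for every t > 0, which is absurd for
   degree reasons when t > d.

   For the k-th power of a path on 0, ..., n-1, both bounds are attained with
   d = ceil(n / (2k+1)), by c_j = j(2k+1) and a_j = min(j(2k+1) + k, n-1). *)

(** * Ideals and regular sequences in a commutative ring *)

Section RegularSequences.

Import GRing.Theory.
Local Open Scope ring_scope.

Variable R : comNzRingType.
Implicit Types (G I J L : R -> Prop) (f g p q : R) (fs : seq R).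

Record is_ideal J : Prop := IsIdeal {
  ideal0 : J 0;
  idealD : forall p q, J p -> J q -> J (p + q);
  idealMl : forall r p, J p -> J (r * p) }.

Lemma idealN J p : is_ideal J -> J p -> J (- p).
Proof. by move=> idJ Jp; rewrite -mulN1r; apply: idealMl. Qed.

Lemma idealB J p q : is_ideal J -> J p -> J q -> J (p - q).
Proof. by move=> idJ Jp Jq; apply: idealD => //; apply: idealN. Qed.

Lemma ideal_sum J (T : Type) (s : seq T) (P : pred T) (F : T -> R) :
  is_ideal J -> (forall i, P i -> J (F i)) -> J (\sum_(i <- s | P i) F i).
Proof. by move=> idJ JF; apply: big_ind => //; case: idJ. Qed.

Lemma mem_ideal_gen G p : G p -> ideal_gen G p.
Proof.
move=> Gp; exists [:: (1, p)]; split; last by rewrite big_seq1 mul1r.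
by move=> cg /[!inE] /eqP ->.
Qed.

Lemma ideal_gen_ideal G : is_ideal (ideal_gen G).
Proof.
split=> [|p q [s [Gs ->]] [t [Gt ->]]|r p [s [Gs ->]]].
- by exists [::]; rewrite big_nil.
- exists (s ++ t); rewrite big_cat; split=> // cg.
  by rewrite mem_cat => /orP[/Gs|/Gt].
- exists [seq (r * cg.1, cg.2) | cg <- s]; split=> [_ /mapP[cg /Gs ? ->]//|].
  by rewrite big_map big_distrr; apply: eq_bigr => cg _ /=; rewrite mulrA.
Qed.

Lemma ideal_gen_min G L :
  is_ideal L -> (forall p, G p -> L p) -> forall p, ideal_gen G p -> L p.
Proof.
move=> idL GL p [s [Gs ->]]; rewrite big_seq; apply: ideal_sum => // cg /Gs/GL.
exact: idealMl.
Qed.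

Definition addgen J f p := exists r, J (p - r * f).
Definition colon J f p := J (f * p).

Lemma addgen_ideal J f : is_ideal J -> is_ideal (addgen J f).
Proof.
move=> idJ; split=> [|p q [r Jr] [s Js]|r p [s Js]].
- by exists 0; rewrite mul0r subr0; apply: ideal0.
- exists (r + s).
  have -> : p + q - (r + s) * f = (p - r * f) + (q - s * f) by ring.
  exact: idealD.
- exists (r * s); have -> : r * p - r * s * f = r * (p - s * f) by ring.
  exact: idealMl.
Qed.

Lemma colon_ideal J f : is_ideal J -> is_ideal (colon J f).
Proof.
move=> idJ; split=> [|p q Jp Jq|r p Jp]; rewrite /colon.
- by rewrite mulr0; apply: ideal0.
- by rewrite mulrDr; apply: idealD.
- by rewrite mulrCA; apply: idealMl.
Qed.

Lemma addgenl J f p : J p -> addgen J f p.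
Proof. by exists 0; rewrite mul0r subr0. Qed.

Lemma addgenr J f : is_ideal J -> addgen J f f.
Proof. by move=> idJ; exists 1; rewrite mul1r subrr; apply: ideal0. Qed.

Lemma addgen_min J L f p :
  is_ideal L -> (forall q, J q -> L q) -> L f -> addgen J f p -> L p.
Proof.
move=> idL JL Lf [r /JL Lr]; rewrite -(subrK (r * f) p).
by apply: idealD => //; apply: idealMl.
Qed.

Lemma addgenC J f g p : addgen (addgen J f) g p -> addgen (addgen J g) f p.
Proof. by move=> [r [s Jrs]]; exists s, r; rewrite addrAC. Qed.

Lemma addgen_ext J L f :
  (forall p, J p <-> L p) -> forall p, addgen J f p <-> addgen L f p.
Proof. by move=> JL p; split=> [[r /JL]|[r /JL]]; exists r. Qed.

(** Properness of the final quotient is left out, so it need not be tracked when passing to colon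
    ideals. Adjoining the head to the ideal suits induction on the sequence with [J] varying. *)
Fixpoint wreg J fs : Prop :=
  if fs is f :: fs' then regular_mod J f /\ wreg (addgen J f) fs' else True.

Lemma wreg_ext fs J L : (forall p, J p <-> L p) -> wreg J fs -> wreg L fs.
Proof.
elim: fs J L => [//|f fs IHfs] J L JL /= [regf regfs]; split.
  by move=> g /JL/regf/JL.
by apply: IHfs regfs; apply: addgen_ext.
Qed.

Lemma ideal_adjoin_nil I : is_ideal I -> forall p, ideal_adjoin I [::] p <-> I p.
Proof.
move=> idI p; split; last by move=> Ip; apply: mem_ideal_gen; left.
by apply: ideal_gen_min => // q [].
Qed.

Lemma ideal_adjoin_cons I f fs : is_ideal I ->
  forall p, ideal_adjoin I (f :: fs) p <-> ideal_adjoin (addgen I f) fs p.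
Proof.
move=> idI p; split; apply: ideal_gen_min; try exact: ideal_gen_ideal.
- move=> q [Iq|]; first by apply: mem_ideal_gen; left; apply: addgenl.
  rewrite inE => /orP[/eqP ->|qfs]; last by apply: mem_ideal_gen; right.
  by apply: mem_ideal_gen; left; apply: addgenr.
- move=> q [|qfs]; last by apply: mem_ideal_gen; right; rewrite inE qfs orbT.
  apply: addgen_min; first exact: ideal_gen_ideal.
    by move=> r Ir; apply: mem_ideal_gen; left.
  by apply: mem_ideal_gen; right; rewrite mem_head.
Qed.

Lemma regular_modP I fs : is_ideal I ->
  (forall i, (i < size fs)%N -> regular_mod (ideal_adjoin I (take i fs)) fs`_i)
  <-> wreg I fs.
Proof.
elim: fs I => [//|f fs IHfs] I idI /=.
have idIf := addgen_ideal f idI.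
split=> [reg|[regf /(IHfs _ idIf) reg] [_|i lti]].
- split.
    move=> g Ig; apply/(ideal_adjoin_nil idI).
    by apply: (reg 0%N isT); apply/(ideal_adjoin_nil idI).
  apply/(IHfs _ idIf) => i lti g /(ideal_adjoin_cons f _ idI) Ig.
  by apply/(ideal_adjoin_cons f _ idI); apply: (reg i.+1).
- by move=> g /(ideal_adjoin_nil idI)/regf Ig; apply/(ideal_adjoin_nil idI).
- move=> g /(ideal_adjoin_cons f _ idI) Ig.
  by apply/(ideal_adjoin_cons f _ idI); apply: reg.
Qed.

(* Regularity lifts along 0 -> R/(J : f) -> R/J -> R/(J + f) -> 0. *)
Lemma wreg_split fs J f :
  is_ideal J -> wreg (colon J f) fs -> wreg (addgen J f) fs -> wreg J fs.
Proof.
elim: fs J => [//|g fs IHfs] J idJ /= [reg1 wreg1] [reg2 wreg2].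
split.
  move=> u Jgu; have [|r Jur] := reg2 u; first exact: addgenl.
  have Jgr : colon J f (g * r).
    rewrite /colon; have -> : f * (g * r) = g * u - g * (u - r * f) by ring.
    by apply: idealB => //; apply: idealMl.
  rewrite -(subrK (r * f) u); apply: idealD => //.
  by rewrite mulrC; apply: reg1.
apply: IHfs; first exact: addgen_ideal.
- apply: wreg_ext wreg1 => p; split=> [[s Js]|[s Js]].
    by exists (f * s); rewrite /colon mulrBr mulrA in Js.
  have [|t Jst] := reg2 s.
    exists p; rewrite -(opprB (p * f)); apply: idealN => //.
    by rewrite mulrC (mulrC g).
  exists t; rewrite /colon.
  have -> : f * (p - t * g) = (f * p - s * g) + g * (s - t * f) by ring.
  by apply: idealD => //; apply: idealMl.
- by apply: wreg_ext wreg2 => p; split; apply: addgenC.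
Qed.

(** For the head [f], induct on the exponent with [wreg_split]: as [f] is regular on R/J, the colon
    of J + (f^(t+2)) by [f] is J + (f^(t+1)), while adding [f] to J + (f^(t+2)) gives J + (f). *)
Lemma wreg_pow fs t J :
  is_ideal J -> wreg J fs -> wreg J [seq f ^+ t.+1 | f <- fs].
Proof.
elim: fs J => [//|f fs IHfs] J idJ /= [regf wregfs].
have regX s : regular_mod J (f ^+ s).
  elim: s => [|s IHs] g; first by rewrite mul1r.
  by rewrite exprS -mulrA => /regf/IHs.
split; first exact: regX.
apply: IHfs; first exact: addgen_ideal.
elim: t => [|t IHt]; first exact: wregfs.
have idX s : is_ideal (addgen J (f ^+ s)) by apply: addgen_ideal.
apply: (@wreg_split _ _ f) => //.
- apply: wreg_ext IHt => p; split=> [[r Jr]|[r Jr]]; exists r.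
    have -> : f * p - r * f ^+ t.+2 = f * (p - r * f ^+ t.+1).
      by rewrite (exprS f t.+1); ring.
    exact: idealMl.
  apply: regf; have -> // : f * (p - r * f ^+ t.+1) = f * p - r * f ^+ t.+2.
  by rewrite (exprS f t.+1); ring.
- apply: wreg_ext wregfs => p; split.
    apply: addgen_min; [exact/addgen_ideal | | exact: addgenr].
    by move=> q Jq; do 2 apply: addgenl.
  apply: addgen_min; [exact/addgen_ideal | | exact: addgenr].
  move=> q; apply: addgen_min; [exact/addgen_ideal | by move=> *; apply: addgenl | ].
  by rewrite exprSr; apply: idealMl; [exact/addgen_ideal | exact: addgenr].
Qed.

End RegularSequences.

(** * Monomial ideals in a polynomial ring *)

Section MonomialIdeals.

Import GRing.Theory.
Local Open Scope ring_scope.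

Variables (K : fieldType) (n : nat).
Local Notation S := {mpoly K[n]}.
Implicit Types (B : 'X_{1..n} -> Prop) (L : S -> Prop) (p q : S).
Implicit Types (m : 'X_{1..n}) (v w : 'I_n) (Z : {set 'I_n}) (e : rel 'I_n).

(** For upward closed [B] this is the ideal spanned by the monomials with exponent in [B]; taking
    the colon by a variable or adding a variable then becomes an operation on [B]. *)
Definition monomial_ideal B p := forall m, m \in msupp p -> B m.

Definition upward B := forall m m', B m -> B (m + m')%MM.

Lemma monomial_ideal_ideal B : upward B -> is_ideal (monomial_ideal B).
Proof.
move=> upB; split=> [m|p q Bp Bq m|r p Bp m].
- by rewrite msupp0.
- by move/msuppD_le; rewrite mem_cat => /orP[/Bp|/Bq].
- move/msuppM_le => /allpairsP[[m1 m2] /= [_ m2p ->]].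
  by rewrite mpoly.addmC; apply/upB/Bp.
Qed.

Lemma monomial_ideal_gen B m : B m -> monomial_ideal B 'X_[m].
Proof. by move=> Bm m'; rewrite msuppX inE => /eqP ->. Qed.

Lemma monomial_ideal_min B L : is_ideal L -> (forall m, B m -> L 'X_[m]) ->
  forall p, monomial_ideal B p -> L p.
Proof.
move=> idL BL p Bp; rewrite [p]mpolyE big_seq; apply: ideal_sum => // m /Bp/BL.
by rewrite -mul_mpolyC; apply: idealMl.
Qed.

Lemma monomial_ideal_ext B B' : (forall m, B m <-> B' m) ->
  forall p, monomial_ideal B p <-> monomial_ideal B' p.
Proof. by move=> BB' p; split=> H m /H/BB'. Qed.

Lemma mpolyX_factor m v : (0 < m v)%N -> 'X_[m] = 'X_[m - U_(v)] * 'X_v :> S.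
Proof.
move=> mv; rewrite -mpolyXD submK //; apply/mnm_lepP => i.
by rewrite mnm1E; case: eqP => // <-.
Qed.

Lemma monomial_ideal_colon B v : forall p,
  colon (monomial_ideal B) 'X_v p <-> monomial_ideal (fun m => B (m + U_(v))%MM) p.
Proof.
move=> p; rewrite /colon; split=> Bp m.
  move=> mp; apply: Bp; rewrite (mulrC 'X_v) mpoly.addmC.
  by rewrite mcoeff_msupp mcoeffMX -mcoeff_msupp.
rewrite (mulrC 'X_v) (perm_mem (msuppMX _ _)) => /mapP[m' /Bp Bm' ->].
by rewrite mpoly.addmC.
Qed.

Lemma monomial_ideal_add B v : upward B -> forall p,
  addgen (monomial_ideal B) 'X_v p
  <-> monomial_ideal (fun m => B m \/ (0 < m v)%N) p.
Proof.
move=> upB p; have idB := monomial_ideal_ideal upB.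
have upBv : upward (fun m => B m \/ (0 < m v)%N).
  by move=> m m' [/upB Bm|mv]; [left | right; rewrite mnmDE addn_gt0 mv].
split.
  apply: addgen_min; first exact: monomial_ideal_ideal.
    by move=> q Bq m /Bq; left.
  by apply: monomial_ideal_gen; right; rewrite mnm1E eqxx.
apply: monomial_ideal_min; first exact: addgen_ideal.
move=> m [Bm|mv]; first by apply: addgenl; apply: monomial_ideal_gen.
by rewrite (mpolyX_factor mv); apply: idealMl; [exact: addgen_ideal | exact: addgenr].
Qed.

Definition edge_monomial e m := exists v w, [/\ e v w, (0 < m v)%N & (0 < m w)%N].

Lemma edge_monomial_upward e : upward (edge_monomial e).
Proof.
move=> m m' [v [w [evw mv mw]]]; exists v, w.
by rewrite !mnmDE !addn_gt0 mv mw.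
Qed.

(** Irreflexivity matters: a loop at v would generate only x_v^2, whereas [edge_monomial] would
    already admit x_v. *)
Lemma edge_idealE e : irreflexive e -> forall p,
  edge_ideal e p <-> monomial_ideal (edge_monomial e) p.
Proof.
move=> irr p; split.
  apply: ideal_gen_min; first exact/monomial_ideal_ideal/edge_monomial_upward.
  move=> _ [v [w [evw ->]]]; rewrite -mpolyXD; apply: monomial_ideal_gen.
  by exists v, w; rewrite !mnmDE !mnm1E !eqxx addn1.
apply: monomial_ideal_min => [|m [v [w [evw mv mw]]]]; first exact: ideal_gen_ideal.
have mvw : (0 < (m - U_(w))%MM v)%N.
  rewrite mnmBE mnm1E; have [wv|_] := eqVneq w v; last by rewrite subn0.
  by rewrite wv irr in evw.
rewrite (mpolyX_factor mw) (mpolyX_factor mvw).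
rewrite -mulrA; apply: idealMl; first exact: ideal_gen_ideal.
by apply: mem_ideal_gen; exists v, w.
Qed.

Definition zero_monomial Z m := exists2 v, v \in Z & (0 < m v)%N.

Lemma zero_monomial_upward Z : upward (zero_monomial Z).
Proof. by move=> m m' [v Zv mv]; exists v; rewrite // mnmDE addn_gt0 mv. Qed.

Lemma graded_maxideal_mem0 p :
  graded_maxideal p -> monomial_ideal (fun m => 0 < mdeg m)%N p.
Proof.
apply: ideal_gen_min => [|_ [i ->]].
  by apply: monomial_ideal_ideal => m m'; rewrite mdegD addn_gt0 => ->.
by apply: monomial_ideal_gen; rewrite mdeg1.
Qed.

Lemma rmorph_ker_ideal (phi : {rmorphism S -> S}) : is_ideal (fun p => phi p = 0).
Proof.
split=> [|p q|r p]; first by rewrite rmorph0.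
- by rewrite rmorphD => -> ->; rewrite addr0.
- by rewrite rmorphM => ->; rewrite mulr0.
Qed.

(** Congruence modulo [L] respects sums and products, so constants and variables suffice. When [phi]
    also kills [L], this identifies [L] with the kernel of [phi]. *)
Lemma ideal_sub_rmorph L (phi : {rmorphism S -> S}) :
    is_ideal L -> (forall c : K, phi c%:MP = c%:MP) ->
    (forall v, L ('X_v - phi 'X_v)) -> forall p, L (p - phi p).
Proof.
move=> idL phiC LX; elim/mpolyind => [|c m p _ _ Lp].
  by rewrite rmorph0 subrr; apply: ideal0.
rewrite rmorphD -mul_mpolyC rmorphM /= phiC.
have -> : c%:MP * 'X_[m] + p - (c%:MP * phi 'X_[m] + phi p) =
          c%:MP * ('X_[m] - phi 'X_[m]) + (p - phi p) by ring.
apply: idealD => //; apply: idealMl => //.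
have cong_mul (x x' y y' : S) : L (x - x') -> L (y - y') -> L (x * y - x' * y').
  move=> Lx Ly; have -> : x * y - x' * y' = y * (x - x') + x' * (y - y') by ring.
  by apply: idealD => //; apply: idealMl.
rewrite mpolyXE_id rmorph_prod.
apply: (big_ind2 (fun x y => L (x - y))) => [|x x' y y'|v _].
- by rewrite subrr; apply: ideal0.
- exact: cong_mul.
- rewrite rmorphXn; elim: (m v) => [|k IHk].
    by rewrite subrr; apply: ideal0.
  by rewrite !exprS; apply: cong_mul.
Qed.

End MonomialIdeals.

(** * Lower bound: sums of variables over disjoint closed neighbourhoods *)

Section LowerBound.

Import GRing.Theory.
Local Open Scope ring_scope.

Variables (K : fieldType) (n : nat).
Local Notation S := {mpoly K[n]}.
Implicit Types (L : S -> Prop) (p q : S) (v w : 'I_n) (Z : {set 'I_n}).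

Definition var_sum (A : {set 'I_n}) : S := \sum_(v in A) 'X_v.

Lemma var_sum_neq0 (A : {set 'I_n}) v : v \in A -> var_sum A != 0.
Proof.
move=> Av; apply/eqP => /(congr1 (mcoeff U_(v))) /eqP.
rewrite mcoeff0 /var_sum raddf_sum (bigD1 v) //= mcoeffXU eqxx big1 ?addr0 ?oner_eq0 //.
by move=> w /andP[_ /negbTE]; rewrite mcoeffXU => ->.
Qed.

Section DisjointForms.

Variables (I : eqType) (A : I -> {set 'I_n}).
Hypothesis A_disjoint : forall i j v, v \in A i -> v \in A j -> i = j.

(* J is kept as the kernel of a retraction [phi] of [S]: killing the next form
   amounts to solving it for one of its variables. *)
Lemma wreg_kernel (Z : {set 'I_n}) (b : I -> 'I_n) (s : seq I) L
    (phi : {rmorphism S -> S}) :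
    uniq s -> is_ideal L ->
    (forall c : K, phi c%:MP = c%:MP) ->
    (forall p, L p <-> phi p = 0) ->
    (forall v, L ('X_v - phi 'X_v)) ->
    (forall i, i \in s -> b i \in A i :\: Z) ->
    (forall i v, i \in s -> v \in A i -> phi 'X_v = if v \in Z then 0 else 'X_v) ->
  wreg L [seq var_sum (A i) | i <- s].
Proof.
elim: s L phi => [//|i s IHs] L phi /= /andP[nis us] idL phiC kerL LX bA phiA.
set f := var_sum (A i); set b0 := b i.
have b0A : b0 \in A i :\: Z by apply: bA; rewrite mem_head.
have phif : phi f = var_sum (A i :\: Z).
  rewrite /f /var_sum raddf_sum /= big_mkcond [RHS]big_mkcond.
  apply: eq_bigr => v _; rewrite inE; case: ifP => [Aiv|_]; last by rewrite andbF.
  by rewrite (phiA i) ?mem_head // andbT; case: ifP.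
(* Through [phi], the quotient S/L embeds in the domain S, so it is enough that [phi f] is
   nonzero. *)
have regf : regular_mod L f.
  move=> g /kerL; rewrite rmorphM /= => /eqP; rewrite mulf_eq0 => /orP[|/eqP/kerL//].
  by rewrite phif (negbTE (var_sum_neq0 b0A)).
split=> //.
(* The variable at [b0] has coefficient 1 in [phi f], so [psi] solves phi f = 0 for it: its image no
   longer involves that variable. *)
pose h v : S := if v == b0 then 'X_v - phi f else 'X_v.
pose psi : {rmorphism S -> S} := mmap (@mpolyC n K) h.
have psiC c : psi c%:MP = c%:MP by rewrite /psi /= mmapC.
have psiX v : psi 'X_v = h v by rewrite /psi /= mmapX mmap1U.
have idLf : is_ideal (addgen L f) by apply: addgen_ideal.
have LphiX : addgen L f (phi f).
  rewrite -[phi f](subKr f); apply: idealB => //; first exact: addgenr.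
  by apply: addgenl; apply: ideal_sub_rmorph.
have psif : psi (phi f) = 0.
  have -> : psi (phi f) = phi f - phi f; last exact: subrr.
  rewrite {1 2}phif /var_sum raddf_sum (bigD1 b0) //= psiX /h eqxx.
  rewrite [in RHS](bigD1 b0) //= addrAC; congr (_ + _ - _).
  by apply: eq_bigr => v /andP[_ /negbTE nvb]; rewrite psiX /h nvb.
apply: (IHs _ (psi \o phi : {rmorphism S -> S})) => //=.
- by move=> c; rewrite phiC psiC.
- move=> p; split.
    apply: (addgen_min (rmorph_ker_ideal (psi \o phi))) => //=.
    by move=> q /kerL ->; rewrite rmorph0.
  move=> psip; rewrite -(subrK (phi p) p) -[X in _ + X]subr0 -psip.
  apply: idealD => //; first by apply: addgenl; apply: ideal_sub_rmorph.
  apply: ideal_sub_rmorph => // v; rewrite psiX /h; case: eqP => _.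
    by rewrite subKr.
  by rewrite subrr; apply: ideal0.
- move=> v; rewrite -[X in addgen _ _ (X - _)](subrK (phi 'X_v)) -addrA.
  apply: idealD => //; first exact: addgenl.
  apply: ideal_sub_rmorph => // w; rewrite psiX /h; case: eqP => _.
    by rewrite subKr.
  by rewrite subrr; apply: ideal0.
- by move=> j sj; apply: bA; rewrite inE sj orbT.
(* The later blocks are disjoint from block [i], hence avoid [b0], and [psi] fixes their
   variables. *)
- move=> j v sj Ajv; rewrite (phiA j) ?inE ?sj ?orbT //.
  case: ifP => _; first by rewrite rmorph0.
  rewrite psiX /h; case: eqP => // vb0; move: b0A nis; rewrite inE -vb0 => /andP[_ Aiv].
  by rewrite (A_disjoint Aiv Ajv) sj.
Qed.

Lemma wreg_zero_monomial (Z : {set 'I_n}) (s : seq I) :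
    uniq s -> (forall i, i \in s -> exists v, v \in A i :\: Z) ->
  wreg (monomial_ideal (zero_monomial Z)) [seq var_sum (A i) | i <- s].
Proof.
move=> us meetA; case: s us meetA => [//|i0 s us meetA].
have [v0 _] := meetA i0 (mem_head _ _).
(* Each block indexed by [s] meets the complement of [Z], so the default [v0] is not reached
   there. *)
pose b i := odflt v0 [pick v in A i :\: Z].
pose h v : S := if v \in Z then 0 else 'X_v.
pose phi : {rmorphism S -> S} := mmap (@mpolyC n K) h.
have phiC c : phi c%:MP = c%:MP by rewrite /phi /= mmapC.
have phiX v : phi 'X_v = h v by rewrite /phi /= mmapX mmap1U.
have idZ : is_ideal (monomial_ideal (K := K) (zero_monomial Z)).
  exact/monomial_ideal_ideal/zero_monomial_upward.
have ZX v : monomial_ideal (zero_monomial Z) ('X_v - phi 'X_v).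
  rewrite phiX /h; case: ifP => Zv; last by rewrite subrr; apply: ideal0.
  rewrite subr0; apply: monomial_ideal_gen; exists v => //.
  by rewrite mnm1E eqxx.
apply: (wreg_kernel (Z := Z) (b := b) (phi := phi)) => //.
- move=> p; split=> [|phip0].
    apply: (monomial_ideal_min (rmorph_ker_ideal phi)) => m [v Zv mv].
    by rewrite (mpolyX_factor _ mv) rmorphM phiX /h Zv mulr0.
  by rewrite -[p]subr0 -phip0; apply: ideal_sub_rmorph.
- move=> i /meetA [v Av]; rewrite /b; case: pickP => [//|/(_ v)].
  by rewrite Av.
Qed.

End DisjointForms.

(** * Branching on the vertices of a graph *)

Section Neighbourhoods.

Variables (e : rel 'I_n) (d : nat) (c : 'I_d -> 'I_n).
Hypotheses (e_sym : ssrbool.symmetric e) (e_irr : irreflexive e).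

Definition closed_nbhd v : {set 'I_n} := [set w | (w == v) || e v w].

Hypothesis nbhd_disjoint :
  forall i j v, v \in closed_nbhd (c i) -> v \in closed_nbhd (c j) -> i = j.

Definition deletion_monomial Z m := zero_monomial Z m \/ edge_monomial e m.

Lemma deletion_monomial_upward Z : upward (deletion_monomial Z).
Proof.
move=> m m' [Zm|em]; first by left; apply: zero_monomial_upward.
by right; apply: edge_monomial_upward.
Qed.

(* Branching on a vertex v: J : x_v deletes the neighbours of v and J + x_v
   deletes v.  As no edge joins two centres, v can be chosen so that no block
   is lost, and each block keeps either its centre or an isolated vertex. *)
Lemma wreg_closed_nbhds Z :
    (forall i, c i \notin Z \/
       exists b, [/\ b \in closed_nbhd (c i), b \notin Z
                   & forall w, e b w -> w \in Z]) ->
  wreg (monomial_ideal (deletion_monomial Z))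
    [seq var_sum (closed_nbhd (c i)) | i <- enum 'I_d].
Proof.
have [k] := ubnP #|~: Z|; elim: k Z => // k IHk Z leZ blockZ.
have idZ : is_ideal (monomial_ideal (K := K) (deletion_monomial Z)).
  exact/monomial_ideal_ideal/deletion_monomial_upward.
have cNadj i j : e (c i) (c j) = false.
  apply/negP => eij; have ij : i = j.
    by apply: (nbhd_disjoint (v := c j)); rewrite !inE ?eij ?eqxx ?orbT.
  by rewrite ij e_irr in eij.
(* Branch on an undeleted non-centre [v] with an undeleted neighbour [u]; each branch deletes at
   least one more vertex, [u] or [v]. *)
have [/existsP[v /and3P[Zv /forallP vNc /existsP[u /andP[evu Zu]]]]|noedge] :=
    boolP [exists v, [&& v \notin Z, [forall i, v != c i]
                      & [exists u, e v u && (u \notin Z)]]].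
  have subZ (T : {set 'I_n}) w : w \in T -> w \notin Z -> (#|~: (Z :|: T)| < k)%N.
    move=> Tw Zw; rewrite -ltnS; apply: leq_ltn_trans leZ; apply: proper_card.
    apply/properP; split; first by rewrite setCS subsetUl.
    by exists w; rewrite !inE ?Tw ?orbT.
  apply: (wreg_split (f := 'X_v)) => //.
    apply: wreg_ext (IHk (Z :|: [set w | e v w]) _ _).
    - move=> p; apply: iff_trans (iff_sym (monomial_ideal_colon _ _ p)).
      apply: monomial_ideal_ext => m; split.
        case=> [[w]|[x [y [exy mx my]]]].
          rewrite !inE => /orP[Zw|evw] mw.
            by left; exists w; rewrite // mnmDE addn_gt0 mw.
          by right; exists v, w; rewrite !mnmDE mnm1E eqxx addn1 addn_gt0 mw.
        by right; exists x, y; rewrite !mnmDE !addn_gt0 mx my.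
      case=> [[w Zw]|[x [y [exy]]]]; rewrite !mnmDE !mnm1E !addn_gt0.
        have [wv|_] := eqVneq v w; first by rewrite -wv (negbTE Zv) in Zw.
        by rewrite orbF => mw; left; exists w; rewrite // inE Zw.
      have [vx|_] := eqVneq v x; have [vy|_] := eqVneq v y; rewrite ?orbF ?orbT.
      + by rewrite -vx -vy e_irr in exy.
      + by move=> _ my; left; exists y; rewrite // !inE vx exy orbT.
      + by move=> mx _; left; exists x; rewrite // !inE vy e_sym exy orbT.
      + by move=> mx my; right; exists x, y.
    - by apply: (subZ _ u) => //; rewrite inE.
    (* If [v] is adjacent to the centre, the centre is lost but [v] takes its place, now isolated.
       An isolated survivor [b] is not adjacent to [v], because [v] was undeleted, so it stays. *)
    - move=> i; case: (blockZ i) => [Zci|[b [Bb Zb Nb]]].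
        have [evc|nevc] := boolP (e v (c i)); last by left; rewrite !inE negb_or Zci.
        right; exists v; rewrite !inE e_irr orbF e_sym evc orbT; split=> // w evw.
        by rewrite !inE evw orbT.
      right; exists b; split=> // [|w ebw]; last by rewrite inE Nb.
      rewrite !inE negb_or Zb; apply/negP => evb.
      by move: Zv; rewrite Nb // e_sym.
  apply: wreg_ext (IHk (Z :|: [set v]) _ _).
  - move=> p; apply: iff_trans (iff_sym (monomial_ideal_add _ _ p)); last first.
      exact: deletion_monomial_upward.
    apply: monomial_ideal_ext => m; split.
      case=> [[w]|em]; last by left; right.
      by rewrite !inE => /orP[Zw mw|/eqP -> mv]; [left; left; exists w | right].
    case=> [[[w Zw mw]|em]|mv]; last by left; exists v; rewrite // !inE eqxx orbT.
      by left; exists w; rewrite // inE Zw.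
    by right.
  - by apply: (subZ _ v) => //; rewrite inE.
  (* Deleting [v] costs no block: [v] is not a centre, and it was not isolated, since [u] was
     undeleted. *)
  - move=> i; case: (blockZ i) => [Zci|[b [Bb Zb Nb]]].
      by left; rewrite !inE negb_or Zci eq_sym vNc.
    right; exists b; split=> // [|w ebw]; last by rewrite inE Nb.
    rewrite !inE negb_or Zb; apply/eqP => bv.
    by move: Zu; rewrite Nb // bv.
(* An edge with both ends undeleted would have a non-centre end to branch on, as two centres are
   never adjacent. Hence every edge monomial already lies in the ideal of deleted variables. *)
have edgeZ v w : e v w -> v \notin Z -> w \in Z.
  move=> evw Zv; apply/negPn/negP => Zw; move/negP: noedge; apply.
  have center x y : e x y -> y \notin Z -> x \notin Z -> [forall i, x != c i] ->
      [exists v, [&& v \notin Z, [forall i, v != c i]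
                  & [exists u, e v u && (u \notin Z)]]].
    move=> exy Zy Zx xNc; apply/existsP; exists x; rewrite Zx xNc.
    by apply/existsP; exists y; rewrite exy.
  have [vNc|/forallPn[i /negPn/eqP vi]] := boolP [forall i, v != c i].
    exact: (center v w).
  have [wNc|/forallPn[j /negPn/eqP wj]] := boolP [forall i, w != c i].
    by apply: (center w v) => //; rewrite e_sym.
  by rewrite vi wj cNadj in evw.
apply: wreg_ext (wreg_zero_monomial nbhd_disjoint (Z := Z) (enum_uniq 'I_d) _).
  apply: monomial_ideal_ext => m; split=> [Zm|]; first by left.
  case=> // -[v [w [evw mv mw]]].
  have [Zv|Zv] := boolP (v \in Z); first by exists v.
  by exists w => //; apply: edgeZ evw _.
move=> i _; case: (blockZ i) => [Zci|[b [Bb Zb _]]].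
  by exists (c i); rewrite !inE Zci eqxx.
by exists b; rewrite inE Zb.
Qed.

Lemma var_sum_graded_maxideal (A : {set 'I_n}) : graded_maxideal (var_sum A).
Proof.
apply: ideal_sum => [|v _]; first exact: ideal_gen_ideal.
by apply: mem_ideal_gen; exists v.
Qed.

Lemma not_ideal_adjoin1 L (fs : seq S) :
    (forall p, L p -> graded_maxideal p) -> (forall f, f \in fs -> graded_maxideal f) ->
  ~ ideal_adjoin L fs 1.
Proof.
move=> Lm fsm L1.
suff /(_ 0%MM) : monomial_ideal (K := K) (fun m : 'X_{1..n} => 0 < mdeg m)%N 1.
  by rewrite mcoeff_msupp mcoeff1 eqxx oner_eq0 mdeg0 => /(_ isT).
apply: graded_maxideal_mem0; move: L1; apply: ideal_gen_min.
  exact: ideal_gen_ideal.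
by move=> p [/Lm|/fsm].
Qed.

Lemma regular_seq_closed_nbhds :
  regular_seq_in (@graded_maxideal K n) (@edge_ideal K n e)
    [seq var_sum (closed_nbhd (c i)) | i <- enum 'I_d].
Proof.
have fsm f : f \in [seq var_sum (closed_nbhd (c i)) | i <- enum 'I_d] ->
    graded_maxideal f.
  by case/mapP=> i _ ->; apply: var_sum_graded_maxideal.
split=> //; split.
  apply/regular_modP; first exact: ideal_gen_ideal.
  apply: wreg_ext (wreg_closed_nbhds (Z := set0) _) => [p|i].
    apply: iff_trans (iff_sym (edge_idealE e_irr p)); apply: monomial_ideal_ext => m.
    by split=> [[[v]|//]|]; [rewrite inE | right].
  by left; rewrite inE.
apply: not_ideal_adjoin1 => // p; apply: ideal_gen_min; first exact: ideal_gen_ideal.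
move=> _ [v [w [_ ->]]]; apply: idealMl; first exact: ideal_gen_ideal.
by apply: mem_ideal_gen; exists w.
Qed.

End Neighbourhoods.

End LowerBound.

(** * Algebraic dependence by counting monomials *)

Section AlgebraicDependence.

Import GRing.Theory.
Local Open Scope ring_scope.

Variables (K : fieldType) (n : nat).
Local Notation S := {mpoly K[n]}.
Implicit Types (J : S -> Prop) (f p q u : S) (fs : seq S) (c : seq nat -> K).

(* The values at [fs] of nonzero polynomials over [K], written so as to exhibit
   their lexicographically least monomial. *)
Inductive nonzero_value : seq S -> S -> Prop :=
| NonzeroValueNil (a : K) : a != 0 -> nonzero_value [::] a%:MP
| NonzeroValueCons i f fs p q :
    nonzero_value fs p -> nonzero_value (f :: fs) (f ^+ i * (p + f * q)).

(** Regularity cancels the power of the head, and reducing modulo the head leaves a relation in the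
    remaining elements. At the end only the coefficient of the least monomial is left, a unit. *)
Lemma wreg_nonzero_value fs J p u : is_ideal J -> wreg J fs ->
  nonzero_value fs p -> J (p * u) -> ideal_adjoin J fs u.
Proof.
move=> idJ wregfs nzp; elim: nzp J idJ wregfs => [a a0|i f {}fs {}p q _ IHp] J idJ.
  move=> _ Jau; apply/(ideal_adjoin_nil idJ).
  have -> : u = (a^-1)%:MP * (a%:MP * u) by rewrite mulrA -mpolyCM mulVf // mul1r.
  exact: idealMl.
move=> [regf wregfs] Jpu; apply/(ideal_adjoin_cons f fs idJ).
apply: IHp => //; first exact: addgen_ideal.
have {}Jpu : J ((p + f * q) * u).
  elim: i Jpu => [|i IHi]; first by rewrite mul1r.
  by rewrite exprS -!mulrA => /regf; rewrite mulrA.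
by exists (- (q * u)); have -> : p * u - - (q * u) * f = (p + f * q) * u by ring.
Qed.

Section Combinations.

Variable N : nat.

(* [comb fs c] is the sum of [c s * \prod_j fs_j ^ s_j] over the sequences [s]
   of exponents less than [N]. *)
Fixpoint comb fs c : S :=
  if fs is f :: fs' then \sum_(i < N) f ^+ i * comb fs' (fun s => c (val i :: s))
  else (c [::])%:MP.

Fixpoint has_coef (r : nat) c : bool :=
  if r is r'.+1 then has (fun i => has_coef r' (fun s => c (i :: s))) (iota 0 N)
  else c [::] != 0.

Lemma has_coefP c (s : seq nat) :
  all (fun i => i < N)%N s -> c s != 0 -> has_coef (size s) c.
Proof.
elim: s c => [//|i s IHs] c /= /andP[ltiN sN] cis.
by apply/hasP; exists i; [rewrite mem_iota | apply: IHs].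
Qed.

Lemma comb_eq0 fs c : ~~ has_coef (size fs) c -> comb fs c = 0.
Proof.
elim: fs c => [|f fs IHfs] c /=; first by rewrite negbK => /eqP ->; rewrite mpolyC0.
move/hasPn => c0; rewrite big1 // => i _.
by rewrite IHfs ?mulr0 //; apply: (c0 (val i)); rewrite mem_iota /= add0n.
Qed.

Lemma comb_nonzero_value fs c :
  has_coef (size fs) c -> nonzero_value fs (comb fs c).
Proof.
elim: fs c => [|f fs IHfs] c /=; first exact: NonzeroValueNil.
pose P i := (i < N)%N && has_coef (size fs) (fun s => c (i :: s)).
move=> /hasP[i]; rewrite mem_iota => ltiN ci.
have exP : exists i, P i by exists i; apply/andP.
(* [i0] is the least exponent of [f] with a nonzero coefficient; the terms below it vanish and the
   terms above it are divisible by one more [f]. *)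
case: (ex_minnP exP) => i0 /andP[lti0N ci0] min_i0.
have -> : \sum_(i < N) f ^+ i * comb fs (fun s => c (val i :: s)) =
    f ^+ i0 * (comb fs (fun s => c (i0 :: s)) +
      f * \sum_(i < N | (i0 < i)%N)
            f ^+ (i - i0.+1) * comb fs (fun s => c (val i :: s))).
  rewrite (bigD1 (Ordinal lti0N)) //= mulrDr; congr (_ + _).
  rewrite mulrA -exprSr big_distrr /= big_mkcond [RHS]big_mkcond /=.
  apply: eq_bigr => j _; rewrite -val_eqE /=.
  case: (ltngtP (val j) i0) => //= [ltj|lti0].
    rewrite comb_eq0 ?mulr0 //; apply/negP => cj.
    by have := min_i0 j; rewrite /P ltn_ord cj leqNgt ltj => /(_ isT).
  by rewrite mulrA -exprD subnKC.
exact/NonzeroValueCons/IHfs.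
Qed.

Lemma comb_sum (T : finType) (v : T -> K) (g : T -> seq nat -> K) fs :
  comb fs (fun s => \sum_t v t * g t s) = \sum_t v t *: comb fs (g t).
Proof.
elim: fs g => [|f fs IHfs] g /=.
  by rewrite raddf_sum; apply: eq_bigr => t _ /=; rewrite mpolyCM mul_mpolyC.
under eq_bigr do rewrite IHfs big_distrr /=.
rewrite exchange_big; apply: eq_bigr => t _ /=.
by rewrite scaler_sumr; apply: eq_bigr => i _; rewrite scalerAr.
Qed.

End Combinations.

Definition mdeg_le D p := forall m, m \in msupp p -> (mdeg m <= D)%N.

Lemma mdeg_le_trans D D' p : (D <= D')%N -> mdeg_le D p -> mdeg_le D' p.
Proof. by move=> leD Dp m /Dp; move/leq_trans; apply. Qed.

Lemma mdeg_le_sum D (I : finType) (F : I -> S) :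
  (forall i, mdeg_le D (F i)) -> mdeg_le D (\sum_i F i).
Proof.
move=> DF; apply: (big_ind (mdeg_le D)) => // [m|p q Dp Dq m]; first by rewrite msupp0.
by move/msuppD_le; rewrite mem_cat => /orP[/Dp|/Dq].
Qed.

Lemma mdeg_leM D D' p q : mdeg_le D p -> mdeg_le D' q -> mdeg_le (D + D') (p * q).
Proof.
move=> Dp Dq m /msuppM_le /allpairsP[[m1 m2] /= [/Dp le1 /Dq le2 ->]].
by rewrite mdegD leq_add.
Qed.

Lemma mdeg_leC D (a : K) : mdeg_le D a%:MP.
Proof.
move=> m; rewrite msuppC; case: ifP => // _.
by rewrite inE => /eqP ->; rewrite mdeg0.
Qed.

Lemma mdeg_leX D p i : mdeg_le D p -> mdeg_le (i * D) (p ^+ i).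
Proof.
move=> Dp; elim: i => [|i IHi]; first by rewrite expr0 -mpolyC1; apply: mdeg_leC.
by rewrite exprS mulSn; apply: mdeg_leM.
Qed.

Lemma mdeg_le_comb N D fs c : (forall f, f \in fs -> mdeg_le D f) ->
  mdeg_le (size fs * (N * D)) (comb N fs c).
Proof.
elim: fs c => [|f fs IHfs] c Dfs /=; first exact: mdeg_leC.
apply: mdeg_le_sum => i; apply: (@mdeg_le_trans (i * D + size fs * (N * D))).
  by rewrite mulSn leq_add2r leq_mul2r ltnW ?orbT.
apply: mdeg_leM; first by apply/mdeg_leX/Dfs; rewrite mem_head.
by apply: IHfs => g gfs; apply: Dfs; rewrite inE gfs orbT.
Qed.

Lemma kermx_vector (m k : nat) (M : 'M[K]_(m, k)) : (k < m)%N ->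
  exists2 v : 'rV_m, v != 0 & v *m M = 0.
Proof.
move=> ltkm; have /rowV0Pn[v /sub_kermxP vM v0] : kermx M != 0.
  rewrite -mxrank_eq0 mxrank_ker subn_eq0 -ltnNge.
  by apply: leq_ltn_trans (rank_leq_col M) ltkm.
by exists v.
Qed.

(* For large [N] there are more products of the [fs] with exponents less than
   [N] than monomials in the [d] chosen variables of the degrees they reach. *)
Lemma algebraic_dependence d (a : 'I_d -> 'I_n) fs : (d < size fs)%N ->
  exists2 p, nonzero_value fs p
           & monomial_ideal (zero_monomial [set v | v \notin codom a]) p.
Proof.
move=> ltd; set r := size fs.
pose D0 := \max_(f <- fs) msize f.
have D0fs f : f \in fs -> mdeg_le D0 f.
  move=> ffs m /msize_mdeg_lt/ltnW/leq_trans; apply.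
  by rewrite /D0 (big_rem f) //= leq_maxl.
(* With this [N], (D+1)^d <= N^d (r D0 + 1)^d < N^(d+1) <= N^r, so exponent tuples outnumber the
   exponents of monomials in the chosen variables. *)
pose N := ((r * D0).+1 ^ d).+1; pose D := (r * (N * D0))%N.
pose T := r.-tuple 'I_N; pose G := {ffun 'I_d -> 'I_D.+1}.
have ltGT : (#|{: G}| < #|{: T}|)%N.
  rewrite card_ffun card_tuple !card_ord.
  apply: leq_ltn_trans (_ : (N * (r * D0).+1) ^ d < _)%N.
    case: (d) => // k; rewrite leq_exp2r // mulnS.
    by rewrite /D mulnCA -add1n leq_add2r.
  rewrite expnMn; apply: leq_trans (_ : N ^ d.+1 <= _)%N.
    by rewrite expnSr ltn_pmul2l ?expn_gt0.
  by rewrite leq_pexp2l.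
pose mon (g : G) : 'X_{1..n} :=
  [multinom (if [pick j | a j == v] is Some j then g j : nat else 0%N) | v < n].
pose delta (i : 'I_#|{: T}|) s : K := (s == map val (enum_val i))%:R.
(* A row vector killed by [M] gives a combination with zero coefficient at every monomial
   [mon g]. *)
pose M := \matrix_(i < #|{: T}|, j < #|{: G}|)
  (comb N fs (delta i))@_(mon (enum_val j)).
have [v v0 vM] := kermx_vector M ltGT.
exists (comb N fs (fun s => \sum_i v 0 i * delta i s)).
  apply: comb_nonzero_value.
  have /rV0Pn[i vi] := v0.
  have size_i : size (map val (enum_val i)) = size fs by rewrite size_map size_tuple.
  rewrite -[X in has_coef _ X]size_i; apply: has_coefP.
    by apply/allP => _ /mapP[j _ ->] /=; apply: ltn_ord.
  rewrite (bigD1 i) //= /delta eqxx mulr1 big1 ?addr0 // => j ji.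
  rewrite (inj_eq (inj_map val_inj)) val_eqE (inj_eq enum_val_inj) eq_sym.
  by rewrite (negbTE ji) mulr0.
move=> m mp.
have [/existsP[w /andP[wa mw]]|/existsPn out] :=
    boolP [exists w, (w \notin codom a) && (0 < m w)%N].
  by exists w; rewrite ?inE.
have degm : (mdeg m <= D)%N by apply: mdeg_le_comb mp.
(* A monomial of the combination in the chosen variables alone has exponents at most [D], so [inord]
   does not alter them and the monomial is [mon g]. *)
pose g : G := [ffun j => inord (m (a j))].
have mg : m = mon g.
  apply/mnmP => w; rewrite mnmE; case: pickP => [j /eqP <-|Nw].
    rewrite ffunE inordK // ltnS; apply: leq_trans degm.
    by rewrite mdegE (bigD1 (a j)) //= leq_addr.
  have := out w; rewrite negb_and negbK -leqNgt leqn0 => /orP[/codomP[j wj]|/eqP//].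
  by have := Nw j; rewrite wj eqxx.
move: mp; rewrite mcoeff_msupp comb_sum raddf_sum /=.
have /matrixP/(_ 0 (enum_rank g)) := vM; rewrite mxE [RHS]mxE => vM0.
case/eqP; rewrite -[RHS]vM0; apply: eq_bigr => i _.
by rewrite mcoeffZ mxE enum_rankK -mg.
Qed.

End AlgebraicDependence.

(** * Upper bound from an independent dominating set *)

Section UpperBound.

Import GRing.Theory.
Local Open Scope ring_scope.

Variables (K : fieldType) (n : nat) (e : rel 'I_n) (d : nat) (a : 'I_d -> 'I_n).
Hypotheses (e_irr : irreflexive e)
  (a_independent : forall i j, e (a i) (a j) = false)
  (a_dominating : forall v, v \notin codom a -> exists i, e v (a i)).
Local Notation S := {mpoly K[n]}.

Lemma monomial_ideal_exp (p : S) t :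
  monomial_ideal (fun m => 0 < mdeg m)%N p ->
  monomial_ideal (fun m => t <= mdeg m)%N (p ^+ t).
Proof.
move=> p0; elim: t => [//|t IHt] m.
rewrite exprS => /msuppM_le /allpairsP[[m1 m2] /= [/p0 m1p /IHt m2p ->]].
by rewrite mdegD -add1n leq_add.
Qed.

(* The monomial u of the independent dominating set is killed modulo the edge
   ideal by the other variables. A relation among the powers [f ^+ d.+1] would
   put u in the ideal they generate with the edges, against its degree. *)
Lemma regular_seq_size_le (fs : seq S) :
  regular_seq_in (@graded_maxideal K n) (@edge_ideal K n e) fs -> (size fs <= d)%N.
Proof.
case=> fsm [regfs _]; rewrite leqNgt; apply/negP => ltd.
have idE : is_ideal (@edge_ideal K n e) by apply: ideal_gen_ideal.
(* The exponent d + 1 pushes every monomial of these powers above degree [d], whereas u has degree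
   at most [d]. *)
have := wreg_pow d idE (proj1 (regular_modP fs idE) regfs).
set fsX := map _ fs => wregX.
have [|p nzp p0] := @algebraic_dependence K n d a fsX; first by rewrite size_map.
pose mu : 'X_{1..n} := [multinom (v \in codom a : nat) | v < n].
have mu_a v : (0 < mu v)%N = (v \in codom a) by rewrite mnmE lt0b.
have pu : edge_ideal e (p * 'X_[mu]).
  rewrite mulrC; move: p p0 {nzp}; apply: monomial_ideal_min.
    exact: (colon_ideal 'X_[mu] idE).
  move=> m [v]; rewrite inE => va mv; apply/(edge_idealE e_irr).
  have [i evi] := a_dominating va.
  rewrite -mpolyXD; apply: monomial_ideal_gen; exists v, (a i).
  by rewrite evi !mnmDE !addn_gt0 !mu_a mv codom_f orbT.
have := wreg_nonzero_value idE wregX nzp pu.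
(* This monomial ideal contains the edges and all the powers, but not u: independence excludes the
   first alternative and degree the second. *)
pose B m := edge_monomial e m \/ (d < mdeg m)%N.
have upB : upward B.
  move=> m m' [em|dm]; first by left; apply: edge_monomial_upward.
  by right; rewrite mdegD ltn_addr.
move=> adj_u; have : monomial_ideal B ('X_[mu] : S).
  move: adj_u; apply: ideal_gen_min; first exact: monomial_ideal_ideal.
  move=> q [/(edge_idealE e_irr) eq m /eq|/mapP[f /fsm/graded_maxideal_mem0 f0 ->] m].
    by left.
  by move/(monomial_ideal_exp f0); right.
move=> /(_ mu); rewrite msuppX mem_head => /(_ isT) [[v [w [evw]]]|].
  by rewrite !mu_a => /codomP[i vi] /codomP[j wj]; rewrite vi wj a_independent in evw.
rewrite ltnNge mdegE; case/negP.
rewrite (eq_bigr (fun v => if v \in codom a then 1 else 0)%N); last first.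
  by move=> v _; rewrite mnmE; case: (_ \in _).
rewrite -big_mkcond sum1_card.
by apply: leq_trans (leq_image_card _ _) _; rewrite card_ord.
Qed.

End UpperBound.

(** * Packing and domination in powers of a path *)

Section PathPowers.

Variables (n k : nat).
Local Notation M := (2 * k + 1).
(** The path has n + 1 vertices in this section, so this is the ceiling of (n + 1) / M. *)
Local Notation d := (n %/ M).+1.

Let M_gt0 : 0 < M. Proof. by rewrite addn1. Qed.

Lemma path_power_sym : ssrbool.symmetric (@path_power n.+1 k).
Proof. by move=> i j; rewrite /path_power orbC. Qed.

Lemma path_power_irr : irreflexive (@path_power n.+1 k).
Proof. by move=> i; rewrite /path_power ltnn. Qed.

Definition packing_center (j : 'I_d) : 'I_n.+1 := inord (j * M).
(** The middle of the j-th block of M consecutive vertices; the minimum covers a last block cut off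
    before its middle. *)
Definition dominating_vertex (j : 'I_d) : 'I_n.+1 := inord (minn (j * M + k) n).

Lemma packing_centerE j : packing_center j = j * M :> nat.
Proof.
by rewrite inordK // ltnS -leq_divRL // -ltnS.
Qed.

Lemma dominating_vertexE j : dominating_vertex j = minn (j * M + k) n :> nat.
Proof. by rewrite inordK // ltnS geq_minr. Qed.

Lemma packing_center_disjoint i j (v : 'I_n.+1) :
  v \in closed_nbhd (@path_power n.+1 k) (packing_center i) ->
  v \in closed_nbhd (@path_power n.+1 k) (packing_center j) -> i = j.
Proof.
rewrite !inE /path_power -!val_eqE /= !packing_centerE => vi vj.
apply: ord_inj; move: vi vj; move: (i : nat) (j : nat) (v : nat) => x y z.
have [lt|lt|//] := ltngtP x y.
- have : x * M + M <= y * M by rewrite -mulSnr leq_mul2r lt orbT.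
  by move: (x * M) (y * M) => *; exfalso; lia.
- have : y * M + M <= x * M by rewrite -mulSnr leq_mul2r lt orbT.
  by move: (x * M) (y * M) => *; exfalso; lia.
Qed.

(** Even when truncated, each chosen vertex lies between its block's start j M and j M + k, so
    vertices of different blocks differ by at least k + 1. *)
Lemma dominating_vertex_independent i j :
  path_power k (dominating_vertex i) (dominating_vertex j) = false.
Proof.
have leM (l : 'I_d) : l * M <= n by rewrite -leq_divRL // -ltnS.
have := leM i; have := leM j.
rewrite /path_power !dominating_vertexE.
move: (i : nat) (j : nat) => x y.
have [lt|lt|->] := ltngtP x y; last by rewrite ltnn.
- have : x * M + M <= y * M by rewrite -mulSnr leq_mul2r lt orbT.
  by move: (x * M) (y * M); lia.
- have : y * M + M <= x * M by rewrite -mulSnr leq_mul2r lt orbT.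
  by move: (x * M) (y * M); lia.
Qed.

(** A vertex is within k of the middle of its own block, found by division by M; if that middle is
    replaced by n, the block has at most k vertices. *)
Lemma dominating_vertex_dominating (v : 'I_n.+1) :
  v \notin codom dominating_vertex -> exists i, path_power k v (dominating_vertex i).
Proof.
move=> vN; have ltd : v %/ M < d by rewrite ltnS leq_div2r // -ltnS.
exists (Ordinal ltd).
have : val v != dominating_vertex (Ordinal ltd).
  by apply: contraNneq vN => /val_inj ->; apply: codom_f.
have vn : v <= n by rewrite -ltnS.
have := divn_eq v M; have : v %% M < M by rewrite ltn_mod addn1.
rewrite /path_power dominating_vertexE /=.
move: (v %/ M * M) (v %% M) => x y; lia.
Qed.

Lemma ceil_path_power :
  `|Num.ceil ((n.+1%:R / M%:R)%R : rat)|%N = d.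
Proof.
have M_gt0R : (0 < M%:R :> rat)%R by rewrite Num.Theory.ltr0n.
rewrite (@Num.Theory.ceil_def _ _ (Posz d)) // Num.Theory.ltr_pdivlMr //.
rewrite Num.Theory.ler_pdivrMr // -addn1 PoszD GRing.addrK -!pmulrn -!GRing.natrM.
rewrite Num.Theory.ltr_nat Num.Theory.ler_nat ltnS leq_divM /=.
by rewrite addn1 ltn_ceil.
Qed.

End PathPowers.

Theorem theorem3p7 (K : fieldType) (n k : nat) (hk : (1 <= k)%N) (hn : (2 <= n)%N) :
  quotient_depth_eq (@graded_maxideal K n) (@edge_ideal K n (@path_power n k))
    `|Num.ceil ((n%:R / (2 * k + 1)%:R)%R : rat)|%N.
Proof.
case: n hn => // n _; rewrite ceil_path_power; split.
  have reg := @regular_seq_closed_nbhds K _ _ _ _ (@path_power_sym n k)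
    (@path_power_irr n k) (@packing_center_disjoint n k).
  by eexists; split; [exact: reg | rewrite size_map size_enum_ord].
move=> fs; apply: regular_seq_size_le; first exact: path_power_irr.
  exact: dominating_vertex_independent.
exact: dominating_vertex_dominating.
Qed.
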